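(* Let $\mathcal{L}=(\bm{X},\bm{E},\bm{F},\mathbb{P}_{\bm{E}})$ and $\mathcal{H}=(\bm{Y},\bm{U},\bm{G},\mathbb{P}_{\bm{U}})$ be structural causal models with sets of admissible (soft) interventions $\mathcal{I}$ and $\mathcal{J}$, where $\mathcal{J}$ contains only hard interventions, and suppose that $\mathcal{H}$ is a low soft $\tau$-abstraction of $\mathcal{L}$ with intervention map $\omega\colon\mathcal{I}\to\mathcal{J}$. Then: 1. $\omega$ is unique, i.e. any other map satisfying the conditions in the definition of low soft $\tau$-abstraction (for the same $\tau_{\bm{Y}},\tau_{\bm{U}}$) agrees with $\omega$ on every $i\in\mathcal{I}$; 2. $\omega(\varepsilon)=\varepsilon$, where $\varepsilon$ denotes the empty intervention (when $\varepsilon$ is admissible at the low level); 3. for all $i_1,i_2\in\mathcal{I}$, $i_1\preceq i_2\implies\omega(i_1)\preceq\omega(i_2)$; 4. there exists a subset $\tilde{\mathcal{I}}\subseteq\mathcal{I}$ of admissible hard interventions such that $\mathcal{H}$ is a $\tau$-abstraction of $\mathcal{L}$ given $\tilde{\mathcal{I}}$ and a subset $\tilde{\mathcal{J}}\subseteq\mathcal{J}$ of high-level interventions as the sets of admissible hard interventions.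
   Context: Each variable $V$ has a domain $\mathrm{Val}(V)$; for a set $\bm{V}$ of variables, $\mathrm{Val}(\bm{V})=\prod_{V\in\bm{V}}\mathrm{Val}(V)$. For $\bm{V}\subseteq\bm{X}$ and $\bm{x}\in\mathrm{Val}(\bm{X})$, $\mathrm{Proj}(\bm{x},\bm{V})\in\mathrm{Val}(\bm{V})$ is the restriction of $\bm{x}$ to the variables $\bm{V}$. A structural causal model (SCM) is a tuple $\mathcal{M}=(\bm{X},\bm{E},\bm{F},\mathbb{P}_{\bm{E}})$ with endogenous variables $\bm{X}$, exogenous variables $\bm{E}$, a family $\bm{F}$ of structural equations $F_X\colon\mathrm{Val}(\bm{X})\times\mathrm{Val}(\bm{E})\to\mathrm{Val}(X)$, $X\in\bm{X}$, and a probability measure $\mathbb{P}_{\bm{E}}$ on $\mathrm{Val}(\bm{E})$. $F_X$ depends only on a subset $\mathrm{Pa}(X)\subseteq\bm{X}\cup\bm{E}$ of variables, the parents of $X$. Standing assumption, for every SCM including every one produced by an intervention: endogenous settings are fully determined by exogenous settings, so for each $\bm{e}\in\mathrm{Val}(\bm{E})$ there is a unique $\bm{x}\in\mathrm{Val}(\bm{X})$ with $\bm{x}=(F_X(\bm{x},\bm{e}))_{X\in\bm{X}}$; write $\mathcal{M}(\bm{e})=\bm{x}$. A soft intervention $i=(\bm{V}\gets\bm{f})$ on $\mathcal{M}$, with $\bm{V}\subseteq\bm{X}$ and $\bm{f}=(f_X)_{X\in\bm{V}}$, $f_X\colon\mathrm{Val}(\bm{X})\times\mathrm{Val}(\bm{E})\to\mathrm{Val}(X)$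 depending at most on $\mathrm{Pa}(X)$, produces the SCM $\mathcal{M}_i=(\bm{X},\bm{E},\bm{F}^i,\mathbb{P}_{\bm{E}})$ with $F^i_X=f_X$ if $X\in\bm{V}$ and $F^i_X=F_X$ otherwise. The empty intervention $\varepsilon$ is the one with $\bm{V}=\emptyset$. A hard intervention $(\bm{V}\gets\bm{v})$, $\bm{v}\in\mathrm{Val}(\bm{V})$, is the special case where each $f_X$ is the constant $\mathrm{Proj}(\bm{v},X)$. Equality of interventions on a model is understood as yielding the same structural equations (interventions yielding the same structural equations are not regarded as distinct). The restriction set of a hard intervention $i=(\bm{V}\gets\bm{v})$ is $\mathrm{Rst}(\mathcal{M}_i)=\{\bm{x}\in\mathrm{Val}(\bm{X})\mid\mathrm{Proj}(\bm{x},\bm{V})=\bm{v}\}$. The soft restriction set of $i=(\bm{V}\gets\bm{f})$, viewing $\bm{f}$ as a joint function $\mathrm{Val}(\bm{X})\times\mathrm{Val}(\bm{E})\to\mathrm{Val}(\bm{V})$, is $\mathrm{SoftRst}(\mathcal{M}_i)=\{\bm{x}\in\mathrm{Val}(\bm{X})\mid\mathrm{Proj}(\bm{x},\bm{V})\in\mathrm{Image}(\bm{f})\}$; in particular $\mathrm{SoftRst}(\mathcal{M}_\varepsilon)=\mathrm{Val}(\bm{X})$. The ordering on soft interventions on $\mathcal{M}$ is $i_1\preceq i_2\iff\mathrm{SoftRst}(\mathcal{M}_{i_1})\supseteq\mathrm{SoftRst}(\mathcal{M}_{i_2})$. Throughout, $\tau_{\bm{Y}}\colon\mathrm{Val}(\bm{X})\to\mathrm{Val}(\bm{Y})$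 and $\tau_{\bm{U}}\colon\mathrm{Val}(\bm{E})\to\mathrm{Val}(\bm{U})$ are surjective, and $\mathcal{I},\mathcal{J}$ are the sets of admissible interventions of $\mathcal{L},\mathcal{H}$. Low soft abstraction: $\mathcal{H}$ is a low soft $\tau$-abstraction of $\mathcal{L}$ if there is a surjective $\omega\colon\mathcal{I}\to\mathcal{J}$ (the intervention map) such that for every $i\in\mathcal{I}$, $\mathrm{SoftRst}(\mathcal{H}_{\omega(i)})=\{\tau_{\bm{Y}}(\bm{x})\mid\bm{x}\in\mathrm{SoftRst}(\mathcal{L}_i)\}$ and $\tau_{\bm{Y}}(\mathcal{L}_i(\bm{e}))=\mathcal{H}_{\omega(i)}(\tau_{\bm{U}}(\bm{e}))$ for all $\bm{e}\in\mathrm{Val}(\bm{E})$. $\tau$-abstraction (for sets $\mathcal{I},\mathcal{J}$ of hard interventions): let $\omega\colon\mathcal{I}\to\mathcal{J}$ be the partial function defined at $i$ whenever there is $\omega(i)\in\mathcal{J}$ with $\mathrm{Rst}(\mathcal{H}_{\omega(i)})=\{\tau_{\bm{Y}}(\bm{x})\mid\bm{x}\in\mathrm{Rst}(\mathcal{L}_i)\}$. $\mathcal{H}$ is a $\tau$-abstraction of $\mathcal{L}$ if $\omega$ is surjective and, for every $i\in\mathcal{I}$ at which $\omega$ is defined and every $\bm{e}\in\mathrm{Val}(\bm{E})$, $\tau_{\bm{Y}}(\mathcal{L}_i(\bm{e}))=\mathcal{H}_{\omega(i)}(\tau_{\bm{U}}(\bm{e}))$. *)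

(* Defs.v *)
From mathcomp Require Import all_boot all_order all_algebra.
From mathcomp Require Import all_classical all_reals.
From mathcomp Require Import ereal topology normedtype measure.

Set Implicit Arguments.
Unset Strict Implicit.
Unset Printing Implicit Defensive.

Local Open Scope classical_set_scope.

(* [pointedType] makes every domain nonempty, which loses nothing: [Val E]
   carries a probability measure, and for each [e : Val E] a structural causal
   model has a solution in [Val X]. No finiteness of [var] is required. *)
Record variables := Variables {
  var :> Type;
  dom : var -> pointedType
}.

Definition Val (X : variables) : Type := forall v : X, dom v.

(* Val(V) for a set V of variables of X: a set coerces to the type of its
   elements, [{v | v \in V}]. *)
Definition ValOn (X : variables) (V : set X) : Type :=
  forall v : V, dom (val v).

Definition Proj (X : variables) (x : Val X) (V : set X) : ValOn V :=
  fun v => x (val v).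
Arguments Proj {X} x V.

Definition depends_only (X E : variables) (T : Type) (S : set (X + E))
    (f : Val X -> Val E -> T) : Prop :=
  forall (x x' : Val X) (e e' : Val E),
    (forall v, S (inl v) -> x v = x' v) ->
    (forall u, S (inr u) -> e u = e' u) ->
    f x e = f x' e'.

Definition equations (X E : variables) : Type :=
  forall v : X, Val X -> Val E -> dom v.

Definition uniquely_solvable (X E : variables) (F : equations X E) : Prop :=
  forall e : Val E, exists! x : Val X, x = (fun v => F v x e).

(* The sigma-algebra of [Val E] is an arbitrary one, given by a generating
   family. *)
Record SCM (R : realType) (X E : variables) := MkSCM {
  Pa : X -> set (X + E);
  eqns : equations X E;
  eqns_Pa : forall v, depends_only (Pa v) (eqns v);
  eqns_solvable : uniquely_solvable eqns;
  exo_sets : set (set (Val E));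
  exo_prob : probability (g_sigma_algebraType exo_sets) R
}.

Lemma solution_ex (R : realType) (X E : variables) (M : SCM R X E)
  (e : Val E) : exists x : Val X, x = (fun v => eqns M v x e).
Proof. by have [x [Hx _]] := eqns_solvable M e; exists x. Qed.

Definition solution (R : realType) (X E : variables) (M : SCM R X E)
  (e : Val E) : Val X := projT1 (cid (solution_ex M e)).

Definition override (X E : variables) (F : equations X E) (V : set X)
    (f : Val X -> Val E -> ValOn V) : equations X E :=
  fun v x e =>
    match pselect (v \in V) with
    | left vV => f x e (exist _ v vV)
    | right _ => F v x e
    end.

(* Soft interventions on M, as pairs (V, f) with f the joint function. The last
   field is the standing assumption that the intervened model again has a
   unique solution for every exogenous setting. *)
Record soft_intervention (R : realType) (X E : variables) (M : SCM R X E) :=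
  SoftIntervention {
    targets : set X;
    mech : Val X -> Val E -> ValOn targets;
    mech_Pa : forall v : targets,
      depends_only (Pa M (val v)) (fun x e => mech x e v);
    mech_solvable : uniquely_solvable (override (eqns M) mech)
  }.
Arguments mech {R X E M} _ _ _.
Arguments mech_Pa {R X E M} _ _ _ _ _ _ _ _.
Arguments mech_solvable {R X E M} _ _.

Section Interventions.
Variables (R : realType) (X E : variables) (M : SCM R X E).

Lemma override_Pa (i : soft_intervention M) (v : X) :
  depends_only (Pa M v) (override (eqns M) (mech i) v).
Proof.
move=> x x' e e' xx' ee'; rewrite /override; case: pselect => [vV|_].
  exact: (mech_Pa i (exist _ v vV) x x' e e').
exact: eqns_Pa xx' ee'.
Qed.

Definition intervene (i : soft_intervention M) : SCM R X E :=
  MkSCM (override_Pa i) (mech_solvable i) (exo_prob M).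

(* Equality of interventions on M: same structural equations. *)
Definition same_intervention (i1 i2 : soft_intervention M) : Prop :=
  eqns (intervene i1) = eqns (intervene i2).

Definition empty_mech (x : Val X) (e : Val E) : ValOn (set0 : set X) :=
  Proj x set0.

Lemma empty_mech_Pa (v : (set0 : set X)) :
  depends_only (Pa M (val v)) (fun x e => empty_mech x e v).
Proof. by case: v => v v0; exfalso; move: v0; rewrite inE. Qed.

Lemma empty_mech_solvable : uniquely_solvable (override (eqns M) empty_mech).
Proof.
have -> : override (eqns M) empty_mech = eqns M; last exact: eqns_solvable.
apply: functional_extensionality_dep => v.
apply/funext => x; apply/funext => e; rewrite /override.
by case: pselect => [v0|//]; exfalso; move: v0; rewrite inE.
Qed.

Definition empty_intervention : soft_intervention M :=
  SoftIntervention empty_mech_Pa empty_mech_solvable.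

Definition SoftRst (i : soft_intervention M) : set (Val X) :=
  [set x | exists x' e, Proj x (targets i) = mech i x' e].

Definition soft_le (i1 i2 : soft_intervention M) : Prop :=
  SoftRst i2 `<=` SoftRst i1.

End Interventions.

Record hard_intervention (R : realType) (X E : variables) (M : SCM R X E) :=
  HardIntervention {
    hard_soft :> soft_intervention M;
    hard_val : ValOn (targets hard_soft);
    hard_mech : forall x e, mech hard_soft x e = hard_val
  }.
Arguments hard_val {R X E M} _ _.

Definition is_hard (R : realType) (X E : variables) (M : SCM R X E)
    (i : soft_intervention M) : Prop :=
  exists h : hard_intervention M, hard_soft h = i.

Definition Rst (R : realType) (X E : variables) (M : SCM R X E)
    (h : hard_intervention M) : set (Val X) :=
  [set x | Proj x (targets h) = hard_val h].

Section Abstractions.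
Variables (R : realType) (X E Y U : variables).
Variables (L : SCM R X E) (H : SCM R Y U).
Variables (tauY : Val X -> Val Y) (tauU : Val E -> Val U).

(* H is a low soft tau-abstraction of L, with intervention map omega : I -> J;
   the values of omega outside I are irrelevant. Surjectivity is up to equality
   of interventions. *)
Definition low_soft_abstraction
    (I : set (soft_intervention L)) (J : set (soft_intervention H))
    (omega : soft_intervention L -> soft_intervention H) : Prop :=
  [/\ set_fun I J omega,
      forall j, J j -> exists2 i, I i & same_intervention (omega i) j,
      forall i, I i -> SoftRst (omega i) = tauY @` SoftRst i &
      forall i, I i -> forall e : Val E,
        tauY (solution (intervene i) e) =
        solution (intervene (omega i)) (tauU e)].

(* The graph of the partial function omega : I -> J: two high-level
   interventions with the same restriction set have the same structural
   equations, so there is at most one value up to equality of interventions. *)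
Definition tau_omega
    (J : set (hard_intervention H))
    (i : hard_intervention L) (j : hard_intervention H) : Prop :=
  J j /\ Rst j = tauY @` Rst i.

Definition tau_abstraction
    (I : set (hard_intervention L)) (J : set (hard_intervention H)) : Prop :=
  (forall j, J j -> exists2 i, I i & tau_omega J i j) /\
  (forall i j, I i -> tau_omega J i j -> forall e : Val E,
     tauY (solution (intervene i) e) = solution (intervene j) (tauU e)).

End Abstractions.

(* Main.v *)
Require Import Defs.
From mathcomp Require Import all_boot all_order all_algebra.
From mathcomp Require Import all_classical all_reals.

Set Implicit Arguments.
Unset Strict Implicit.
Unset Printing Implicit Defensive.

Local Open Scope classical_set_scope.

(** A hard intervention is determined by its restriction set: applying the
    intervened equations to any setting gives a point of that set, so two hard
    interventions with the same restriction set send every setting to points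
    agreeing on both target sets, and off both target sets the equations are
    the original ones. The target sets themselves may differ, on variables with
    a one-point domain. Domains being nonempty, soft restriction sets extend
    restriction sets; hence the hard value [omega i] is determined by the image
    of [SoftRst i], from which every claim follows. For the last one we take
    all admissible hard low-level interventions, not the trivial empty family. *)

Section Models.
Variables (R : realType) (X E : variables).

(** [solution] is a choice, but unique solvability leaves nothing to choose. *)
Lemma eq_solution (M1 M2 : SCM R X E) (e : Val E) :
  eqns M1 = eqns M2 -> solution M1 e = solution M2 e.
Proof.
move=> eqF; rewrite /solution; case: cid => x1 /= x1E; case: cid => x2 /= x2E.
have [x [_ xU]] := eqns_solvable M1 e.
by rewrite -(xU x1 x1E) (xU x2) // {1}x2E eqF.
Qed.

Variable M : SCM R X E.

Lemma SoftRst_hard (h : hard_intervention M) : SoftRst h = Rst h.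
Proof.
apply/seteqP; split => [x [x' [e xh]]|x xh];
  first exact: etrans xh (hard_mech h x' e).
(* The mechanism is constant, so any arguments serve as witnesses. *)
by exists x, (fun=> point); rewrite hard_mech.
Qed.

Lemma SoftRst_empty : SoftRst (empty_intervention M) = setT.
Proof. by apply/seteqP; split => // x _; exists x, (fun=> point). Qed.

Lemma empty_is_hard : is_hard (empty_intervention M).
Proof.
(* With no targets, the default serves as the hard value. *)
suff hm x e : mech (empty_intervention M) x e = (fun=> point).
  by exists (HardIntervention hm).
apply: functional_extensionality_dep => -[v v0].
by exfalso; move: v0; rewrite inE.
Qed.

Lemma Rst_eqns (h : hard_intervention M) (x : Val X) (e : Val E) :
  Rst h (fun v => eqns (intervene h) v x e).
Proof.
apply: functional_extensionality_dep => -[v vh].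
rewrite /Proj /= /override; case: pselect => // vh'.
(* [pselect] supplies its own membership proof [vh'], to be identified with [vh]. *)
by rewrite hard_mech (bool_irrelevance vh' vh).
Qed.

Lemma Rst_inj (h1 h2 : hard_intervention M) :
  Rst h1 = Rst h2 -> same_intervention h1 h2.
Proof.
move=> eqR; apply: functional_extensionality_dep => v.
apply/funext => x; apply/funext => e.
have h11 := Rst_eqns h1 x e; have h22 := Rst_eqns h2 x e.
have h12 := h11; rewrite eqR in h12; have h21 := h22; rewrite -eqR in h21.
case: (pselect (v \in targets h1)) => [v1|v1].
  exact: (congr1 (@^~ (exist _ v v1)) (etrans h11 (esym h21))).
case: (pselect (v \in targets h2)) => [v2|v2].
  exact: (congr1 (@^~ (exist _ v v2)) (etrans h12 (esym h22))).
by rewrite /= /override; case: pselect => // _; case: pselect.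
Qed.

Lemma SoftRst_inj (i1 i2 : soft_intervention M) :
  is_hard i1 -> is_hard i2 -> SoftRst i1 = SoftRst i2 ->
  same_intervention i1 i2.
Proof. by move=> [h1 <-] [h2 <-]; rewrite !SoftRst_hard; exact: Rst_inj. Qed.

End Models.

(** Keeping only those [j] whose restriction set is the image of one of an admissible hard [i] makes
    the partial map surjective. *)
Lemma hard_tau_abstraction (R : realType) (X E Y U : variables)
    (L : SCM R X E) (H : SCM R Y U)
    (tauY : Val X -> Val Y) (tauU : Val E -> Val U)
    (I : set (soft_intervention L)) (J : set (soft_intervention H))
    (J_hard : forall j, J j -> is_hard j)
    (omega : soft_intervention L -> soft_intervention H)
    (omega_abs : low_soft_abstraction tauY tauU I J omega) :
  tau_abstraction tauY tauU [set i : hard_intervention L | I i]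
    [set j : hard_intervention H |
      J j /\ exists2 i : hard_intervention L, I i & Rst j = tauY @` Rst i].
Proof.
have [IJ _ omega_Rst omega_sol] := omega_abs.
split=> [j [Jj [i Ii ji]]|i j /= Ii [[Jj _] ji] e];
  first by exists i => //; do !split=> //; exists i.
(* [omega i] and [j] may differ as records, but both restrict to the image of [Rst i]. *)
rewrite omega_sol //; apply/eq_solution/SoftRst_inj.
- exact/J_hard/IJ.
- by exists j.
- by rewrite omega_Rst // !SoftRst_hard ji.
Qed.

Theorem mainTheorem6 (R : realType) (X E Y U : variables)
    (L : SCM R X E) (H : SCM R Y U)
    (tauY : Val X -> Val Y) (tauU : Val E -> Val U)
    (tauY_surj : set_surj setT setT tauY)
    (tauU_surj : set_surj setT setT tauU)
    (I : set (soft_intervention L)) (J : set (soft_intervention H))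
    (J_hard : forall j, J j -> is_hard j)
    (omega : soft_intervention L -> soft_intervention H)
    (omega_abs : low_soft_abstraction tauY tauU I J omega) :
  [/\ forall omega' : soft_intervention L -> soft_intervention H,
        low_soft_abstraction tauY tauU I J omega' ->
        forall i, I i -> same_intervention (omega' i) (omega i),
      I (empty_intervention L) ->
        same_intervention (omega (empty_intervention L)) (empty_intervention H),
      forall i1 i2, I i1 -> I i2 ->
        soft_le i1 i2 -> soft_le (omega i1) (omega i2) &
      exists (It : set (hard_intervention L)) (Jt : set (hard_intervention H)),
        [/\ forall i, It i -> I i,
            forall j, Jt j -> J j &
            tau_abstraction tauY tauU It Jt]].
Proof.
have [IJ _ omega_Rst _] := omega_abs; split.
- move=> omega' [IJ' _ omega'_Rst _] i Ii; apply: SoftRst_inj.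
  + exact/J_hard/IJ'.
  + exact/J_hard/IJ.
  + by rewrite omega'_Rst // omega_Rst.
- move=> I0; apply: SoftRst_inj; [exact/J_hard/IJ | exact: empty_is_hard |].
  rewrite omega_Rst // !SoftRst_empty.
  (* Surjectivity of [tauY] makes the image all of [Val Y]. *)
  by apply/seteqP; split => // y /tauY_surj.
- move=> i1 i2 Ii1 Ii2 le12; rewrite /soft_le !omega_Rst //.
  exact: image_subset.
- exists [set i : hard_intervention L | I i], [set j : hard_intervention H |
    J j /\ exists2 i : hard_intervention L, I i & Rst j = tauY @` Rst i].
  by split=> // [j [] //|]; exact: hard_tau_abstraction omega_abs.
Qed.
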